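(* Let $u:\mathbb{R}^n\to\mathbb{R}$ satisfy $u\le 0$ in $\mathbb{R}^n\setminus S_1$ and $M^+u(x)\ge -f(x)$ in $S_1$, let $\Gamma$ be the concave envelope of $u$, and let $\Sigma:=\{u=\Gamma\}\cap S_1$. For each $x\in\Sigma$, let $S_{r}(x)$, $r=r(x)\in(0,r_0)$, $r_0=2^{-1/(2-\sigma)}$, be a section of the detachment family described in the context. Then there is a constant $C>0$ such that $$C(\sup u)^n\le\Big|\bigcup_{x\in\Sigma}S_{r(x)}(x)\Big|.$$
   Context: Setting. Fix constants $0<g_-\le g^+<\infty$ and a convex function $\phi\in C^2(\mathbb{R}^n)$ with $g_-\le\det D^2\phi\le g^+$ in $\mathbb{R}^n$. For $x,y\in\mathbb{R}^n$ put $v_x(y)=\phi(y)-\phi(x)-\nabla\phi(x)\cdot(y-x)\ge0$, and let $S_r(x)=\{y: v_x(y)<r^2\}$ (a section), $S_r:=S_r(0)$. Let $\gamma>1$ be an engulfing constant: $y\in S_r(x)$ implies $S_r(x)\subset S_{\gamma r}(y)$. Let $\tau>\gamma$ be a constant such that whenever $x\in S_1(0)$ and at least one of $x+y$, $x-y$ is not in $S_\tau(0)$, neither of them is in $S_1(0)$. Operators. Fix $\Lambda\ge\lambda>0$, $\sigma\in(0,2)$. With $\delta(u,x,y)=u(x+y)+u(x-y)-2u(x)$ and $\delta^\pm$ its positive and negative parts, $$M^+u(x)=(2-\sigma)\int_{\mathbb{R}^n}\frac{\Lambda\delta^+-\lambda\delta^-}{v_x(x+y)^{\frac{n+\sigma}{2}}}\,dy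 .$$ $M^+u\ge -f$ in an open set $\Omega$ is understood in the viscosity sense: $u$ is upper semicontinuous in $\overline\Omega$ and, whenever $B_r(x_0)\subset\Omega$ and $\varphi\in C^2(\overline{B_r(x_0)})$ satisfies $\varphi(x_0)=u(x_0)$ and $\varphi>u$ in $B_r(x_0)\setminus\{x_0\}$, the function $w$ equal to $\varphi$ in $B_r(x_0)$ and to $u$ elsewhere satisfies $M^+w(x_0)\ge -f(x_0)$. The function $f$ is bounded and continuous in $\mathbb{R}^n$. Concave envelope. $\Gamma(x)=\min\{p(x): p \text{ is a plane (affine function) and } p\ge u^+ \text{ in } S_\tau\}$ for $x\in S_\tau$, and $\Gamma=0$ in $\mathbb{R}^n\setminus S_\tau$. $\nabla\Gamma(x)$ denotes any element of the superdifferential of $\Gamma$ at $x$, and $\nabla\Gamma(E)$ is the union of the superdifferentials over $E$. Detachment family. A small $\varepsilon\in(0,1)$ is fixed. For each $x\in\Sigma$, $r=r(x)\in(0,r_0)$ is a number such that, with a constant $C_1=C_1(n,\varepsilon)>0$, $$\left|(S_r(x)\setminus S_{r/2}(x))\cap\{y: u(y)<u(x)+\nabla\Gamma(x)\cdot(y-x)-C_1f(x)r^2\}\right|\le\varepsilon|S_r(x)\setminus S_{r/2}(x)|$$ and $|\nabla\Gamma(S_{r/4}(x))|\le C_1f(x)^n|S_{r/4}(x)|$. Such $r(x)$ exists for every $x\in\Sigma$. $|E|$ denotes Lebesgue measure.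
   Formalization: sup u is read as max(sup u, 0): if sup u < 0 (for example u = -1, f ≥ 0), then Σ is empty and the union has measure 0, while (sup u)^n > 0 for even n, so the literal inequality fails. *)

(* Defs.v *)
From HB Require Import structures.
From mathcomp Require Import all_boot all_order all_algebra.
From mathcomp Require Import all_classical all_reals all_analysis.
Set Implicit Arguments.
Unset Strict Implicit.
Unset Printing Implicit Defensive.
Import Order.TTheory GRing.Theory Num.Theory.
Import numFieldTopology.Exports numFieldNormedType.Exports.
Local Open Scope classical_set_scope.
Local Open Scope ring_scope.

(* The ambient space R^d, d >= 1, is 'rV[R]_n.+1, with d = n.+1.  Its library
   norm is the sup norm; it is used here only through the topology and the
   directional derivatives it induces. *)

Section Euclidean.
Context {R : realType} {n : nat}.
Implicit Types (x y p : 'rV[R]_n.+1) (r : R).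

Definition dot p y : R := \sum_i p 0 i * y 0 i.

Definition eball x r : set 'rV[R]_n.+1 := [set y | dot (y - x) (y - x) < r ^+ 2].

Definition closed_eball x r : set 'rV[R]_n.+1 :=
  [set y | dot (y - x) (y - x) <= r ^+ 2].

End Euclidean.

(* The library has no Lebesgue measure on R^d: we take the Lebesgue outer measure
   and its Caratheodory restriction. *)
Section Lebesgue.
Context {R : realType} {n : nat}.
Local Notation V := 'rV[R]_n.+1.
Local Open Scope ereal_scope.

Definition box (ab : V * V) : set V :=
  [set x | forall i, (ab.1 0 i < x 0 i <= ab.2 0 i)%R].

Definition box_vol (ab : V * V) : R :=
  (\prod_i Num.max 0 (ab.2 0 i - ab.1 0 i))%R.

Definition leb (A : set V) : \bar R :=
  ereal_inf [set \sum_(k <oo) (box_vol (F k))%:E |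
    F in [set F : (V * V)^nat | A `<=` \bigcup_k box (F k)]].

Let box_vol_ge0 ab : 0 <= (box_vol ab)%:E.
Proof. by rewrite lee_fin; apply: prodr_ge0 => i _; rewrite le_max lexx. Qed.

Let leb_ge0 A : 0 <= leb A.
Proof. by apply: le_ereal_inf_tmp => _ [F _ <-]; exact: nneseries_ge0. Qed.

Let leb0 : leb set0 = 0.
Proof.
apply/eqP; rewrite eq_le leb_ge0 andbT.
apply: ereal_inf_lbound; exists (fun=> (0, 0)%R); first exact: sub0set.
apply: eseries0 => k _ _; rewrite /box_vol (bigD1 ord0)//=.
by rewrite subrr maxxx mul0r.
Qed.

Let le_leb : {homo leb : A B / A `<=` B >-> A <= B}.
Proof.
move=> A B AB; apply: ereal_inf_le_tmp => _ [F BF <-].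
by exists F => //; exact: subset_trans AB BF.
Qed.

Let leb_sigma_subadditive : sigma_subadditive leb.
Proof.
move=> A; have [[i ioo]|] := pselect (exists i, leb (A i) = +oo).
  rewrite (eseries_pinfty _ _ ioo) ?leey// => k _.
  by rewrite -ltNye (lt_le_trans _ (leb_ge0 _)).
rewrite -forallNE => Aoo; apply/lee_addgt0Pr => e e0.
rewrite (le_trans _ (epsilon_trick _ _ (ltW e0)))//.
have [G PG] : {G : ((V * V)^nat)^nat & forall k,
    A k `<=` \bigcup_j box (G k j) /\
    \sum_(j <oo) (box_vol (G k j))%:E <= leb (A k) + (e / (2 ^ k.+1)%:R)%:E}.
  apply: (@choice _ _ (fun k F => A k `<=` \bigcup_j box (F j) /\
    \sum_(j <oo) (box_vol (F j))%:E <= leb (A k) + (e / (2 ^ k.+1)%:R)%:E)) => k.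
  have ek : (0 < e / (2 ^ k.+1)%:R)%R by rewrite divr_gt0// ltr0n expn_gt0.
  have fin : leb (A k) \is a fin_num.
    by rewrite ge0_fin_numE// ltey; apply/eqP; exact: Aoo.
  have [_ [F AF <-] xS] := lb_ereal_inf_adherent ek fin.
  by exists F; split => //; exact/ltW.
have /card_esym/ppcard_eqP[f] := card_nat2.
apply: (@le_trans _ _ (\sum_(k <oo) \sum_(j <oo) (box_vol (G k j))%:E)); last first.
  by apply: lee_nneseries => k *; [exact: nneseries_ge0 | exact: (PG k).2].
apply: ereal_inf_lbound; exists (uncurry G \o f).
  move=> t [i _ /(PG i).1[j _ Bt]]; exists (f^-1%FUN (i, j)) => //=.
  by rewrite invK ?inE.
rewrite nneseries_esumT//=.
rewrite -(reindex_esum setT setT f (fun ij => (box_vol (uncurry G ij))%:E))//.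
rewrite [RHS]nneseries_esumT; last by move=> k; exact: nneseries_ge0.
under [RHS]eq_esum do rewrite nneseries_esumT//.
rewrite esum_esum//.
rewrite (_ : [set: nat] `*`` _ = setT); last by apply/seteqP; split => -[].
by apply: eq_esum => -[].
Qed.

HB.instance Definition _ := isOuterMeasure.Build R V leb
  leb0 leb_ge0 le_leb leb_sigma_subadditive.

Definition leb_outer : {outer_measure set V -> \bar R} := leb.

Definition lebesgue_rV : {measure set (caratheodory_type leb_outer) -> \bar R} :=
  leb_outer : set (caratheodory_type leb_outer) -> \bar R.

End Lebesgue.

Section Calculus.
Context {R : realType} {n : nat}.
Local Notation V := 'rV[R]_n.+1.
Implicit Types (f : V -> R) (U : set V).

Definition partial (i : 'I_n.+1) f : V -> R := 'D_(delta_mx 0 i) f.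

Definition grad f (x : V) : V := \row_i partial i f x.

Definition hessian f (x : V) : 'M[R]_n.+1 :=
  \matrix_(i, j) partial i (partial j f) x.

(* meaningful for U open *)
Definition C2_on U f := forall x, U x ->
  {for x, continuous f} /\
  forall i, [/\ derivable f x (delta_mx 0 i),
    {for x, continuous (partial i f)} &
    forall j, derivable (partial i f) x (delta_mx 0 j) /\
      {for x, continuous (partial j (partial i f))}].

(* C^2 up to the boundary of B_r(x), as the restriction to the closed ball of
   a function that is C^2 in a neighbourhood of it *)
Definition C2_closed_ball (x : V) (r : R) f :=
  exists U, [/\ open U, closed_eball x r `<=` U & C2_on U f].

Definition usc_on (A : set V) (u : V -> R) := forall x, A x ->
  forall a, u x < a -> \forall y \near within A (nbhs x), u y < a.

End Calculus.

Section MongeAmpere.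
Context {R : realType} {n : nat}.
Local Notation V := 'rV[R]_n.+1.
Variable phi : V -> R.

Definition bregman (x y : V) : R := phi y - phi x - dot (grad phi x) (y - x).

Definition msection (x : V) (r : R) : set V := [set y | bregman x y < r ^+ 2].

Definition engulfing (gamma : R) := 1 < gamma /\
  forall x y r, 0 < r -> msection x r y -> msection x r `<=` msection y (gamma * r).

Definition separating (tau : R) := forall x y : V, msection 0 1 x ->
  ~ msection 0 tau (x + y) \/ ~ msection 0 tau (x - y) ->
  ~ msection 0 1 (x + y) /\ ~ msection 0 1 (x - y).

Definition second_diff (u : V -> R) (x y : V) : R := u (x + y) + u (x - y) - 2 * u x.

(* The kernel at y = 0 is set to 0 by the convention 0^-1 = 0. *)
Definition Mplus (lambda Lambda sigma : R) (u : V -> R) (x : V) : \bar R :=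
  ((2 - sigma)%:E * \int[lebesgue_rV]_(y in [set: caratheodory_type leb_outer])
    ((Lambda * Num.max (second_diff u x y) 0
      - lambda * Num.max (- second_diff u x y) 0)
     / (bregman x (x + y)) `^ ((n.+1%:R + sigma) / 2))%:E)%E.

Definition glue (B : set V) (psi u : V -> R) (y : V) : R :=
  if y \in B then psi y else u y.

Definition Mplus_visc_ge (lambda Lambda sigma : R) (Omega : set V)
    (u f : V -> R) :=
  usc_on (closure Omega) u /\
  forall (x0 : V) (r : R) (psi : V -> R), 0 < r ->
    eball x0 r `<=` Omega ->
    C2_closed_ball x0 r psi ->
    psi x0 = u x0 ->
    (forall y, eball x0 r y -> y != x0 -> u y < psi y) ->
    ((- f x0)%:E <= Mplus lambda Lambda sigma (glue (eball x0 r) psi u) x0)%E.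

Section Envelope.
Variables (tau : R) (u : V -> R).

Definition plane_above (p : V) (c : R) := forall y, msection 0 tau y ->
  Num.max (u y) 0 <= dot p y + c.

(* The infimum is a minimum as soon as u is bounded above on S_tau. *)
Definition envelope (x : V) : R :=
  if x \in msection 0 tau
  then inf [set t | exists p c, plane_above p c /\ t = dot p x + c]
  else 0.

(* The envelope is concave on S_tau only (it is extended by 0 outside), so its
   superdifferential is that of its restriction to S_tau. *)
Definition superdiff (x : V) : set V := [set p | msection 0 tau x /\
  forall y, msection 0 tau y -> envelope y <= envelope x + dot p (y - x)].

Definition superdiff_image (E : set V) : set V := \bigcup_(x in E) superdiff x.

Definition contact_set : set V := [set x | u x = envelope x] `&` msection 0 1.

Definition detachment_family (sigma eps C1 : R) (f : V -> R) (r : V -> R) :=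
  forall x, contact_set x ->
  [/\ 0 < r x < 2 `^ (- (2 - sigma)^-1),
    forall p, superdiff x p ->
      (leb ((msection x (r x) `\` msection x (r x / 2)) `&`
            [set y | (u y < u x + dot p (y - x) - C1 * f x * r x ^+ 2)%R])
       <= eps%:E * leb (msection x (r x) `\` msection x (r x / 2)))%E &
    (leb (superdiff_image (msection x (r x / 4)))
     <= (C1 * f x ^+ n.+1)%:E * leb (msection x (r x / 4)))%E].

End Envelope.
End MongeAmpere.

(* Main.v *)
(* Write M = sup u > 0.  The Monge-Ampere lower bound makes phi strictly convex,
   so S_tau is bounded, say by D, and every plane of slope |p| <= c M / D, lowered
   until it touches the graph of u^+ over S_tau, touches it at a point of Sigma;
   hence |grad Gamma (Sigma)| >= c M^d.  By engulfing, a Vitali selection gives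
   points x_k of Sigma such that the sections S_(r_k / 8 gamma^2)(x_k) are disjoint
   while the S_(r_k / 4)(x_k) cover Sigma; then
     c M^d <= sum_k |grad Gamma (S_(r_k / 4)(x_k))|
           <= C1 K^d sum_k |S_(r_k / 4)(x_k)|
           <= C sum_k |S_(r_k / 8 gamma^2)(x_k)| <= C |bigcup_x S_(r(x))(x)|,
   where the third step is the doubling property, a consequence of convexity
   alone. *)
Require Import Defs.
From HB Require Import structures.
From mathcomp Require Import all_boot all_order all_algebra.
From mathcomp Require Import all_classical all_reals all_analysis.
From mathcomp Require Import measurable_realfun ring lra.
Import Order.TTheory GRing.Theory Num.Theory.
Import numFieldTopology.Exports numFieldNormedType.Exports.
Local Open Scope classical_set_scope.
Local Open Scope ring_scope.

(** * Lebesgue outer measure on R^d *)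

Section LebesgueMeasure.
Context {R : realType} {n : nat}.
Local Notation V := 'rV[R]_n.+1.

Lemma box_vol_ge0 (ab : V * V) : (0 <= (box_vol ab)%:E)%E.
Proof. by rewrite lee_fin; apply: prodr_ge0 => i _; rewrite le_max lexx. Qed.

(** Pulling a cover of [A] back along the affine map gives boxes again, with every edge divided by
    [t]. *)
Lemma leb_preimage_affine (A : set V) (t : R) (b : V) : 0 < t ->
  (leb [set y : V | A (t *: y + b)%R]
   <= (t^-1 ^+ n.+1)%:E * leb A)%E.
Proof.
move=> t0; have ti0 : 0 < t^-1 by rewrite invr_gt0.
rewrite -ereal_inf_pZl ?exprn_gt0//.
apply: le_ereal_inf_tmp => _ [_ [F AF <-] <-].
rewrite -nneseriesZl; last by move=> k _; exact: box_vol_ge0.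
apply: ereal_inf_lbound.
exists (fun k => (t^-1 *: ((F k).1 - b), t^-1 *: ((F k).2 - b))).
  move=> y /= /AF[k _ Fk]; exists k => // i.
  have := Fk i; rewrite !mxE => /andP[h1 h2].
  by rewrite ltr_pdivrMl// ler_pdivlMl// ltrBlDr lerBrDr h1.
apply: eq_eseriesr => k _; rewrite -EFinM; congr EFin.
have -> : t^-1 ^+ n.+1 = \prod_(i < n.+1) t^-1 by rewrite prodr_const card_ord.
rewrite /box_vol -big_split/=.
apply: eq_bigr => i _; rewrite !mxE -mulrBr opprB addrA subrK.
by rewrite maxr_pMr ?ltW// mulr0.
Qed.

(** The pieces of a box above and below the hyperplane at height [c] in coordinate [i]: [cut_lo]
    raises the lower corner, [cut_hi] lowers the upper one. Half-open boxes split without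
    overlap. *)
Let cut_lo i c (ab : V * V) : V * V :=
  (\row_j (if j == i then Num.max c (ab.1 0 j) else ab.1 0 j), ab.2).
Let cut_hi i c (ab : V * V) : V * V :=
  (ab.1, \row_j (if j == i then Num.min (ab.2 0 j) c else ab.2 0 j)).

Let box_vol_cut i c ab :
  box_vol ab = box_vol (cut_lo i c ab) + box_vol (cut_hi i c ab).
Proof.
rewrite /box_vol (bigD1 i)//= [in RHS](bigD1 i)//= [X in _ = _ + X](bigD1 i)//=.
rewrite !mxE eqxx.
under [X in _ = _ * X + _]eq_bigr => j /negbTE ji do rewrite mxE ji.
under [X in _ = _ + _ * X]eq_bigr => j /negbTE ji do rewrite mxE ji.
rewrite -mulrDl; congr (_ * _).
set a := ab.1 0 i; set b := ab.2 0 i.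
by case: (leP c a) => ca; case: (leP b c) => bc; case: (leP 0 (b - a)) => h1;
  repeat (case: leP => ?); lra.
Qed.

(** Cutting every box of a cover of [X] gives covers of the two parts of [X] with the same total
    volume. *)
Lemma halfspace_caratheodory i (c : R) :
  caratheodory_measurable (@leb_outer R n) [set x : V | c < x 0 i].
Proof.
apply: le_caratheodory_measurable => X.
apply: le_ereal_inf_tmp => _ [F XF <-].
under eq_eseriesr do rewrite (box_vol_cut i c) EFinD.
rewrite nneseriesD; try by move=> k _ _; exact: box_vol_ge0.
apply: leeD; apply: ereal_inf_lbound.
- exists (fun k => cut_lo i c (F k)) => // x [/XF[k _ Fk] /= cx].
  exists k => // j; rewrite mxE/=; have /andP[h1 h2] := Fk j; rewrite h2 andbT.
  by case: eqP => [ji|//]; rewrite gt_max h1 ji cx.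
- exists (fun k => cut_hi i c (F k)) => // x [/XF[k _ Fk] /= /negP].
  rewrite -leNgt => cx.
  exists k => // j; rewrite mxE/=; have /andP[h1 h2] := Fk j; rewrite h1/=.
  by case: eqP => [ji|//]; rewrite le_min h2 ji cx.
Qed.

Lemma box_caratheodory (ab : V * V) :
  measurable (box ab : set (caratheodory_type (@leb_outer R n))).
Proof.
rewrite (_ : box ab = \bigcap_(i in [set: 'I_n.+1])
   ([set x : V | ab.1 0 i < x 0 i] `&` ~` [set x : V | ab.2 0 i < x 0 i])).
  apply: fin_bigcap_measurable => // i _.
  by apply: measurableI; [|apply: measurableC]; exact: halfspace_caratheodory.
apply/seteqP; split=> [x xab i _|x xab i].
  by have /andP[h1 h2] := xab i; split => //=; apply/negP; rewrite -leNgt.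
by have [h1 /= /negP] := xab i I; rewrite -leNgt => ->; rewrite h1.
Qed.

Lemma open_nbhs_coord (U : set V) (x : V) : open U -> U x ->
  exists2 e : R, 0 < e & forall y : V, (forall i, `|x 0 i - y 0 i| < e) -> U y.
Proof.
move=> oU Ux; have /nbhs_ballP[e /= e0 eU] := open_nbhs_nbhs (conj oU Ux).
exists e => // y xy; apply: eU; split => // i j; rewrite (ord1 i); exact: xy.
Qed.

(** Rational boxes serve as a countable base: open sets become countable unions of boxes, and
    disjoint open sets can be counted. *)
Lemma rat_box (x : V) (e : R) : 0 < e ->
  exists pq : 'rV[rat]_n.+1 * 'rV[rat]_n.+1,
    let ab := (map_mx ratr pq.1, map_mx ratr pq.2) in
    box ab x /\ forall y, box ab y -> forall i, `|x 0 i - y 0 i| < e.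
Proof.
move=> e0.
have [p px] : {p : 'I_n.+1 -> rat & forall i, x 0 i - e < ratr (p i) < x 0 i}.
  apply: (@choice _ _ (fun i q => x 0 i - e < ratr q < x 0 i)) => i.
  have /rat_in_itvoo[q] : x 0 i - e < x 0 i by rewrite ltrBlDr ltrDl.
  by rewrite in_itv => xq; exists q.
have [q qx] : {q : 'I_n.+1 -> rat & forall i, x 0 i < ratr (q i) < x 0 i + e}.
  apply: (@choice _ _ (fun i q => x 0 i < ratr q < x 0 i + e)) => i.
  have /rat_in_itvoo[q] : x 0 i < x 0 i + e by rewrite ltrDl.
  by rewrite in_itv => xq; exists q.
exists (\row_i p i, \row_i q i); split=> [i|y yab i]; rewrite /= ?mxE.
  by have /andP[_ ->] := px i; have /andP[/ltW-> _] := qx i.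
have := yab i; rewrite !mxE/= => /andP[h1 h2].
have /andP[h3 _] := px i; have /andP[_ h4] := qx i.
by rewrite ltr_distlC; apply/andP; split; lra.
Qed.

Lemma open_caratheodory (U : set V) : open U ->
  measurable (U : set (caratheodory_type (@leb_outer R n))).
Proof.
move=> oU.
pose B (pq : 'rV[rat]_n.+1 * 'rV[rat]_n.+1) : set V :=
  box (map_mx ratr pq.1, map_mx ratr pq.2).
(* The inclusion in [U] sits inside each set, so that the union runs over a whole countable type;
   boxes not contained in [U] contribute nothing. *)
rewrite (_ : U = \bigcup_pq [set y | B pq y /\ B pq `<=` U]).
  apply: countable_bigcupT_measurable; first exact: countableP.
  move=> pq; have [BU|nBU] := pselect (B pq `<=` U).
    rewrite (_ : [set y | _] = B pq); first exact: box_caratheodory.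
    by apply/seteqP; split=> [y []//|y].
  rewrite (_ : [set y | _] = set0); first exact: measurable0.
  by apply/seteqP; split=> [y []//|y].
apply/seteqP; split=> [x Ux|x [pq _ [/[swap]]]]; last exact.
have [e e0 eU] := open_nbhs_coord U x oU Ux.
have [pq [xB Be]] := rat_box x e e0.
by exists pq => //; split => // y By; apply: eU; exact: Be.
Qed.

(* Integrating the inequality [1 <= sum of indicators] over the unit cube one
   coordinate at a time replaces each indicator by the length of an edge. *)
Lemma leb_unit_cube : (1 <= leb (@box R n (0%R, const_mx 1%R)))%E.
Proof.
apply: le_ereal_inf_tmp => _ [F cF <-].
pose len k i : R := Num.max 0 ((F k).2 0 i - (F k).1 0 i).
pose chi k i : R -> R := \1_(`](F k).1 0 i, (F k).2 0 i]%classic).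
(* Coordinates below [m] have been integrated out and carry an edge length; the others still carry
   an indicator. *)
pose w m k (x : 'I_n.+1 -> R) : R :=
  \prod_(i < n.+1) if (i < m)%N then len k i else chi k i (x i).
have len0 k i : 0 <= len k i by rewrite le_max lexx.
have chi0 k i t : 0 <= chi k i t by rewrite /chi indicE.
have w0 m k x : (0 <= (w m k x)%:E)%E.
  by rewrite lee_fin; apply: prodr_ge0 => i _; case: ifP.
suff H m : (m <= n.+1)%N -> forall x : 'I_n.+1 -> R, (forall i, 0 < x i <= 1) ->
    (1 <= \sum_(k <oo) (w m k x)%:E)%E.
  have /(_ (fun=> 1)) := H _ (leqnn _).
  rewrite (_ : \sum_(k <oo) (w n.+1 k _)%:E =
               \sum_(k <oo) (box_vol (F k))%:E)%E.
    by apply=> i; rewrite ltr01 lexx.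
  apply: eq_eseriesr => k _; congr EFin; apply: eq_bigr => i _.
  by rewrite ltn_ord.
elim: m => [_ x x01|m IH mn x x01].
  have [k _ Fk] : (\bigcup_k box (F k)) (\row_i x i).
    by apply: cF => i; rewrite !mxE x01.
  rewrite (le_trans _ (@nneseries_lim_ge _ _ _ 0 k.+1 _))//=.
  rewrite big_nat_recr//= (le_trans _ (leeDr _ _))//; last first.
    by apply: sume_ge0.
  rewrite lee_fin /w big1// => i _; rewrite /= /chi indicE.
  rewrite mem_set//=.
  by have := Fk i; rewrite !mxE in_itv.
pose m' := Ordinal mn.
pose c k : R := \prod_(i < n.+1 | i != m')
  if (i < m)%N then len k i else chi k i (x i).
have c0 k : 0 <= c k by apply: prodr_ge0 => i _; case: ifP.
pose xt t i := if i == m' then t else x i.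
have wt k t : w m k (xt t) = c k * chi k m' t.
  rewrite /w (bigD1 m')//= ltnn /xt eqxx mulrC; congr (_ * _).
  by apply: eq_bigr => i /negbTE ->.
have wS k : w m.+1 k x = c k * len k m'.
  rewrite /w (bigD1 m')//= ltnSn mulrC; congr (_ * _).
  apply: eq_bigr => i im; rewrite ltnS leq_eqVlt.
  rewrite (_ : (i == m :> nat) = false)//.
  by apply: contraNF im => /eqP im; apply/eqP/val_inj.
have mchi k : measurable_fun setT (chi k m') by exact: measurable_indic.
have mw k (D : set R) : measurable_fun D (fun t : R => (c k * chi k m' t)%:E).
  apply: measurable_funTS; apply/measurable_EFinP.
  exact: measurable_funM (measurable_cst _) (mchi k).
(* The inequality for [m] is integrated over the unit interval in coordinate [m]; each indicator
   gives at most the edge length. *)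
have : (\int[lebesgue_measure]_(t in `]0%R, 1%R]) (1 : \bar R)
    <= \int[lebesgue_measure]_(t in `]0%R, 1%R])
         \sum_(k <oo) (c k * chi k m' t)%:E)%E.
  apply: ge0_le_integral => //=.
    apply: ge0_emeasurable_sum => [k t tD kP|k kP]; last exact: mw.
    by rewrite lee_fin mulr_ge0.
  move=> t; rewrite in_itv/= => t01.
  under eq_eseriesr do rewrite -wt.
  by apply: (IH (ltnW mn)) => i; rewrite /xt; case: eqP.
rewrite integral_cst//= lebesgue_measure_itv/= lte_fin ltr01 oppr0 mul1e adde0.
rewrite integral_nneseries//=; last 2 first.
  by move=> k; exact: mw.
  by move=> k t _; rewrite lee_fin mulr_ge0.
move/le_trans; apply; apply: lee_nneseries => [k _ _|k _].
  by apply: integral_ge0 => t _; rewrite lee_fin mulr_ge0.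
under eq_integral do rewrite EFinM.
rewrite ge0_integralZl//=; last 3 first.
  by apply/measurable_EFinP; apply: measurable_funTS; exact: mchi.
  by move=> t _; rewrite lee_fin.
  by rewrite lee_fin.
rewrite wS EFinM lee_wpmul2l ?lee_fin// integral_indic//=.
apply: (@le_trans _ _ (lebesgue_measure
    (`](F k).1 0 m', (F k).2 0 m']%classic : set R))).
  by rewrite le_measure ?inE//=; exact: measurableI.
rewrite lebesgue_measure_itv/= lte_fin; case: ifP => _; last by rewrite lee_fin.
by rewrite -EFinD lee_fin le_max lexx orbT.
Qed.

Lemma leb_cube_ge (s : R) : 0 < s ->
  ((s ^+ n.+1)%:E <= leb [set p : V | forall i, (`|p 0 i| <= s)%R])%E.
Proof.
move=> s0; set Q := (X in leb X).
have := leb_preimage_affine Q s 0 s0; rewrite exprVn lee_pdivlMl ?exprn_gt0//.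
apply: le_trans; rewrite -[leLHS]mule1.
rewrite lee_wpmul2l ?lee_fin ?exprn_ge0 ?(ltW s0)//.
apply: (le_trans leb_unit_cube); apply: (@le_outer_measure _ _ leb_outer).
move=> y y01 i; rewrite !mxE addr0; have := y01 i; rewrite !mxE => /andP[h1 h2].
by rewrite ger0_norm ?mulr_ge0 ?(ltW s0) ?(ltW h1)// ger_pMr.
Qed.

End LebesgueMeasure.

(** * Sections of a convex function with nonsingular Hessian *)

Section Calculus.
Context {R : realType} {n : nat}.
Local Notation V := 'rV[R]_n.+1.
Implicit Types (g : V -> R) (x y z : V).

Lemma coord_le_norm x i : `|x 0 i| <= `|x|.
Proof.
rewrite [leRHS]/Num.norm /= mx_normrE.
exact: (le_bigmax _ (fun ij => `|x ij.1 ij.2|) (0, i)).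
Qed.

Lemma dotZr (p x : V) t : dot p (t *: x) = t * dot p x.
Proof. by rewrite /dot mulr_sumr; apply: eq_bigr => i _; rewrite mxE mulrCA. Qed.

Lemma dotDr (p x y : V) : dot p (x + y) = dot p x + dot p y.
Proof.
by rewrite /dot -big_split/=; apply: eq_bigr => i _; rewrite mxE mulrDr.
Qed.

Lemma dot_bound (p y : V) (s D : R) : (forall i, `|p 0 i| <= s) -> `|y| <= D ->
  `|dot p y| <= n.+1%:R * (s * D).
Proof.
move=> ps yD; rewrite (le_trans (ler_norm_sum _ _ _))//.
rewrite (_ : n.+1%:R * _ = \sum_(i < n.+1) s * D); last first.
  by rewrite sumr_const card_ord mulr_natl.
apply: ler_sum => i _; rewrite normrM ler_pM// (le_trans _ yD)//.
exact: coord_le_norm.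
Qed.

Lemma dot_continuous (p : V) : continuous (dot p).
Proof.
apply: continuous_big => [|i _]; first exact: add_continuous.
move=> y; apply: continuousM; first exact: cst_continuous.
exact: coord_continuous.
Qed.

Lemma coord_MVT g i x (s : R) : (forall z, derivable g z (delta_mx 0 i)) ->
  exists2 c, `|c| <= `|s| &
    g (x + s *: delta_mx 0 i) - g x = s * partial i g (x + c *: delta_mx 0 i).
Proof.
move=> dg; pose e : V := delta_mx 0 i; pose k (t : R) := g (x + t *: e).
have dk (t : R) : is_derive t (1 : R) k (partial i g (x + t *: e)).
  have E : (fun h : R => h^-1 *: ((k \o shift t) (h *: 1) - k t)) =
      (fun h : R => h^-1 *:
        ((g \o shift (x + t *: e)) (h *: e) - g (x + t *: e))).
    apply/funext => h; rewrite /k/=; congr (_ *: (g _ - _)).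
    by rewrite [h%:A]mulr1 scalerDl addrCA.
  by split; [rewrite /derivable E; exact: dg|rewrite /derive E].
have ck : continuous k.
  by move=> t; apply: differentiable_continuous; apply/derivable1_diffP.
have [s0|s0] := leP 0 s.
  have [c] := MVT_segment s0 (fun t _ => dk t) (continuous_subspaceT ck).
  rewrite in_itv/= => /andP[c0 cs]; rewrite /k scale0r addr0 subr0 => ->.
  by exists c; rewrite ?ger0_norm// mulrC.
have [c] := MVT_segment (ltW s0) (fun t _ => dk t) (continuous_subspaceT ck).
rewrite in_itv/= => /andP[cs c0]; rewrite /k scale0r addr0 sub0r => E.
exists c; first by rewrite ler0_norm// ltr0_norm// lerN2.
by rewrite -[LHS]opprB E mulrN opprK mulrC.
Qed.

(** The point moves from [z] one coordinate at a time. The mean value theorem turns each move into a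
    partial derivative at a nearby point, and continuity at [z] compares it with the value at [z].
    The lemma serves [phi] and its partial derivatives alike. *)
Lemma C1_directional g z y : (forall x i, derivable g x (delta_mx 0 i)) ->
  (forall i, {for z, continuous (partial i g)}) ->
  forall e, 0 < e -> exists2 d, 0 < d & forall h, `|h| < d ->
    `|g (z + h *: y) - g z - h * \sum_i y 0 i * partial i g z| <= e * `|h|.
Proof.
move=> dg cg e e0.
pose S := \sum_i `|y 0 i|; have S0 : 0 <= S by apply: sumr_ge0.
have S1 : 0 < S + 1 by rewrite ltr_wpDl.
have : \forall w \near z, forall i,
    `|partial i g z - partial i g w| < e / (S + 1).
  apply: (@filter_forall _ 'I_n.+1
    (fun i w => `|partial i g z - partial i g w| < e / (S + 1))
    (nbhs z) _) => i.
  by apply: (cvgr_dist_lt _ _ (cg i)); rewrite divr_gt0.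
move=> /nbhs_ballP[d /= d0 dP].
exists (d / (`|y| + 1)); first by rewrite divr_gt0// ltr_wpDl.
move=> h; rewrite ltr_pdivlMr ?ltr_wpDl// => hd.
have hy i : `|h * y 0 i| < d.
  rewrite normrM (le_lt_trans _ hd)// ler_wpM2l//.
  by rewrite (le_trans (coord_le_norm _ _))// lerDl.
pose P k : V := \row_j (z 0 j + if (j < k)%N then h * y 0 j else 0).
have PS (i : 'I_n.+1) : P i.+1 = P i + (h * y 0 i) *: delta_mx 0 i.
  apply/rowP => j; rewrite !mxE eqxx/= ltnS leq_eqVlt -val_eqE/=.
  have [ji|ji] := eqVneq (j : nat) i; last by rewrite mulr0 addr0.
  have /val_inj -> := ji.
  by rewrite ltnn mulr1 addr0.
have P0 : P 0 = z by apply/rowP => j; rewrite !mxE ltn0 addr0.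
have Pn : P n.+1 = z + h *: y by apply/rowP => j; rewrite !mxE ltn_ord.
rewrite -Pn -[g z]/(g z) -{1}P0 -(telescope_sumr (fun k => g (P k)))//.
rewrite big_mkord mulr_sumr -sumrB.
apply: (le_trans (ler_norm_sum _ _ _)).
(* Dividing by [S + 1] rather than [S] covers [y = 0] and leaves a nonnegative remainder to
   discard. *)
have -> : e * `|h| = \sum_(i < n.+1) (e / (S + 1)) * (`|h| * `|y 0 i|) +
    e / (S + 1) * `|h|.
  rewrite -mulr_sumr -mulr_sumr -/S; field.
  by rewrite gt_eqF.
rewrite -[leLHS]addr0 lerD ?mulr_ge0 ?invr_ge0 ?(ltW e0) ?(ltW S1)//.
apply: ler_sum => i _; rewrite PS.
have [c cs ->] := coord_MVT g i (P i) (h * y 0 i) (dg ^~ i).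
rewrite mulrA -mulrBr normrM [X in _ <= X]mulrC [`|h * _|]normrM.
apply: ler_wpM2l; first by rewrite mulr_ge0.
rewrite ltW// distrC; apply: dP; split => // i0 j; rewrite (ord1 i0).
rewrite /ball/= !mxE eqxx/= -val_eqE/=.
have [ji|ji] := eqVneq (j : nat) i.
  have /val_inj -> := ji.
  by rewrite ltnn mulr1 addr0 opprD addNKr normrN (le_lt_trans cs).
rewrite mulr0 addr0 opprD addNKr normrN.
by case: ifP => _; rewrite ?normr0.
Qed.

End Calculus.

(** * Positivity and nondegeneracy of [bregman phi x]; bounded sections *)

Section Bregman.
Context {R : realType} {n : nat}.
Local Notation V := 'rV[R]_n.+1.
Variable phi : V -> R.
Hypothesis hconv : @convex_function R V setT phi.
Implicit Types x y : V.

Lemma convex_segment x y (t : R) : 0 <= t <= 1 ->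
  phi (x + t *: (y - x)) <= (1 - t) * phi x + t * phi y.
Proof.
move=> /andP[t0 t1].
have := hconv (Itv01 t0 t1) y x (mem_set (I : setT y)) (mem_set (I : setT x)).
rewrite convRE /= /unstable.onem addrC => h.
rewrite (le_trans _ h)//.
rewrite le_eqVlt; apply/orP; left; apply/eqP; congr phi.
rewrite /conv/= /unstable.onem scalerBr scalerBl scale1r.
by rewrite addrC -!addrA; congr (_ + _); rewrite addrC.
Qed.

Lemma bregman_segment x y (t : R) : 0 <= t <= 1 ->
  bregman phi x (x + t *: (y - x)) <= t * bregman phi x y.
Proof.
move=> t01; have := convex_segment x y t t01; rewrite /bregman.
rewrite [x + _ - x]addrC addKr dotZr; lra.
Qed.

Hypothesis hC2 : C2_on setT phi.

Lemma phi_derivable x i : derivable phi x (delta_mx 0 i).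
Proof. by have [_ /(_ i)[]] := hC2 x I. Qed.

Lemma partial_continuous i : continuous (partial i phi).
Proof. by move=> x; have [_ /(_ i)[]] := hC2 x I. Qed.

Lemma partial_derivable i x j : derivable (partial i phi) x (delta_mx 0 j).
Proof. by have [_ /(_ i)[_ _ /(_ j)[]]] := hC2 x I. Qed.

Lemma hessian_continuous i j : continuous (partial j (partial i phi)).
Proof. by move=> x; have [_ /(_ i)[_ _ /(_ j)[]]] := hC2 x I. Qed.

Lemma bregman_continuous x : continuous (bregman phi x).
Proof.
have cd : continuous (fun y => dot (grad phi x) (y - x)).
  move=> y; apply: (@continuous_comp _ _ _ (fun y : V => y - x)).
    by apply: continuousB; [exact: cvg_id|exact: cst_continuous].
  exact: dot_continuous.
move=> y; apply: (@continuousB _ _ _ (fun y => phi y - phi x)); last exact: cd.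
by apply: continuousB; [have [] := hC2 y I|exact: cst_continuous].
Qed.

Lemma phi_directional x y e : 0 < e -> exists2 d, 0 < d & forall h, `|h| < d ->
  `|phi (x + h *: y) - phi x - h * dot (grad phi x) y| <= e * `|h|.
Proof.
move=> e0; have [d d0 dP] :=
  C1_directional phi x y phi_derivable (fun i => partial_continuous i x) e e0.
exists d => // h /dP; rewrite /dot.
by under eq_bigr do rewrite mulrC; under [in X in _ -> X]eq_bigr do rewrite mxE.
Qed.

(** By convexity, a negative value would push [phi] below its tangent plane by an amount linear in
    [h] along the segment, against the first-order expansion. *)
Lemma bregman_ge0 x y : 0 <= bregman phi x y.
Proof.
rewrite leNgt; apply/negP => v0.
have e0 : 0 < - bregman phi x y / 2 by rewrite divr_gt0 ?oppr_gt0.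
have [d d0 dP] := phi_directional x (y - x) _ e0.
pose h := Num.min (d / 2) 1.
have h0 : 0 < h by rewrite lt_min ltr01 divr_gt0.
have hd : h < d by rewrite gt_min ltr_pdivrMr// ltr_pMr// ltr1n.
have h1 : h <= 1 by rewrite ge_min lexx orbT.
have := dP h; rewrite gtr0_norm// => /(_ hd) /ler_normlP[+ _].
have := convex_segment x y h; rewrite h1 ltW// => /(_ isT).
have : h * bregman phi x y < 0 by rewrite pmulr_rlt0.
rewrite /bregman; nra.
Qed.

Lemma bregman_xx x : bregman phi x x = 0.
Proof.
by rewrite /bregman !subrr /dot sub0r big1 ?oppr0// => i _; rewrite !mxE mulr0.
Qed.

Hypothesis hdet : forall x, \det (hessian phi x) != 0.

(* If v_x vanishes at y, it vanishes on the whole segment, so the gradient is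
   constant there and y - x is in the kernel of the Hessian at the midpoint. *)
Lemma bregman_eq0 x y : bregman phi x y = 0 -> y = x.
Proof.
move=> vxy; apply/eqP; rewrite -subr_eq0; apply: contraT => yx0.
pose w (t : R) := x + t *: (y - x).
have vw t : 0 <= t <= 1 -> bregman phi x (w t) = 0.
  move=> t01; apply/eqP; rewrite eq_le bregman_ge0 andbT.
  by have := bregman_segment x y t t01; rewrite vxy mulr0.
(* The points [w t] minimise the nonnegative function [bregman phi x], so its partial derivatives
   vanish there; the increments [d / 2] and [- (d / 2)] give the two inequalities. *)
have gw t : 0 <= t <= 1 -> forall i, partial i phi (w t) = partial i phi x.
  move=> t01 i; apply/eqP; rewrite -subr_eq0 -normr_le0.
  apply/ler_addgt0Pr => e e0; rewrite add0r; pose ei : V := delta_mx 0 i.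
  have dotei z : dot (grad phi z) ei = partial i phi z.
    rewrite /dot (bigD1 i)//= !mxE !eqxx mulr1 big1 ?addr0// => j /negbTE ji.
    by rewrite !mxE ji andbF mulr0.
  have [d d0 dP] := phi_directional (w t) ei _ e0.
  have lb h : h * partial i phi x <= phi (w t + h *: ei) - phi (w t).
    have := bregman_ge0 x (w t + h *: ei); have := vw t t01.
    rewrite /bregman (_ : w t + h *: ei - x = (w t - x) + h *: ei); last first.
      by rewrite addrAC.
    have -> : dot (grad phi x) (w t - x + h *: ei) =
        dot (grad phi x) (w t - x) + h * partial i phi x; last by lra.
    by rewrite dotDr dotZr dotei.
  have h0 : 0 < d / 2 by rewrite divr_gt0.
  have hd : d / 2 < d by rewrite ltr_pdivrMr// ltr_pMr// ltr1n.
  have := dP (d / 2); rewrite gtr0_norm// => /(_ hd) /ler_normlP[_].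
  have := dP (- (d / 2)); rewrite normrN gtr0_norm// => /(_ hd) /ler_normlP[_].
  have := lb (d / 2); have := lb (- (d / 2)); rewrite dotei => l1 l2 u1 u2.
  apply/ler_normlP; split; rewrite -(ler_pM2l h0); lra.
have half01 : 0 <= (2^-1 : R) <= 1 by lra.
have Hy : (y - x) *m hessian phi (w 2^-1) = 0.
  apply/rowP => i; rewrite [LHS]mxE [RHS]mxE.
  have -> : \sum_j (y - x) 0 j * hessian phi (w 2^-1) j i =
      \sum_j (y - x) 0 j * partial j (partial i phi) (w 2^-1).
    by apply: eq_bigr => j _; rewrite [hessian _ _ _ _]mxE.
  apply/eqP; rewrite -normr_le0.
  apply/ler_addgt0Pr => e e0; rewrite add0r.
  have [d d0 dP] := C1_directional (partial i phi) (w 2^-1) (y - x)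
    (partial_derivable i)
    (fun j => hessian_continuous i j _) e e0.
  (* The bound 1/2 keeps [w (2^-1 + h)] on the segment, where the gradient is constant and the
     difference quotient vanishes. *)
  pose h := Num.min (d / 2) 2^-1.
  have h0 : 0 < h by rewrite lt_min invr_gt0 ltr0n divr_gt0.
  have hd : h < d by rewrite gt_min ltr_pdivrMr// ltr_pMr// ltr1n.
  have h1 : h <= 2^-1 by rewrite ge_min lexx orbT.
  have := dP h; rewrite gtr0_norm// => /(_ hd).
  rewrite (_ : w 2^-1 + h *: (y - x) = w (2^-1 + h)); last first.
    by rewrite /w scalerDl addrA.
  rewrite !gw//; last by apply/andP; split; lra.
  rewrite subrr sub0r normrN normrM gtr0_norm// mulrC ler_pM2r//.
have : \det (hessian phi (w 2^-1)) == 0 by apply/det0P; exists (y - x).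
by rewrite (negbTE (hdet _)).
Qed.

(** On the unit sphere around [x] the function [bregman phi x] has a positive minimum m, and
    convexity along rays makes it at least m |y - x| outside the unit ball. *)
Lemma msection_bounded x (r : R) :
  exists2 D, 0 < D & forall y, msection phi x r y -> `|y - x| <= D.
Proof.
pose S := [set y : V | `|y - x| = 1].
have S0 : S !=set0.
  pose e : V := const_mx 1; have e0 : `|e| != 0.
    rewrite normr_eq0; apply/eqP => /rowP/(_ 0); rewrite !mxE => /eqP.
    by rewrite oner_eq0.
  exists (x + `|e|^-1 *: e); rewrite /S/= addrC addKr normrZ normfV normr_id.
  by rewrite mulVf.
have cS : compact S.
  apply: bounded_closed_compact.
    exists (`|x| + 1); split => // M xM y Sy.
    rewrite /= -[y](subrK x) (le_trans (ler_normD (y - x) x))//.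
    by rewrite (Sy : `|y - x| = 1) addrC ltW.
  rewrite (_ : S = (fun y => `|y - x|) @^-1` [set 1]); last by [].
  apply: preimage_closed; last exact: closed_eq.
  move=> y _; apply: (@continuous_comp _ _ _ (fun y : V => y - x) Num.norm).
    by apply: continuousB; [exact: cvg_id|exact: cst_continuous].
  exact: norm_continuous.
have [c cSc cmin] :=
  EVT_min_rV S0 cS (continuous_subspaceT (bregman_continuous x)).
have m0 : 0 < bregman phi x c.
  rewrite lt_neqAle bregman_ge0 andbT; apply/eqP => /esym/bregman_eq0 cx.
  move: cSc; rewrite inE /S/= cx subrr normr0 => /eqP.
  by rewrite eq_sym oner_eq0.
exists (1 + r ^+ 2 / bregman phi x c).
  by rewrite ltr_wpDr// divr_ge0 ?sqr_ge0// ltW.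
move=> y yr; have [y1|y1] := leP `|y - x| 1.
  by rewrite (le_trans y1)// lerDl divr_ge0 ?sqr_ge0// ltW.
have d0 : 0 < `|y - x| by rewrite (lt_trans ltr01).
have t01 : 0 <= `|y - x|^-1 <= 1.
  by rewrite invr_ge0 ltW//= invf_le1// ltW.
have : bregman phi x c <= bregman phi x (x + `|y - x|^-1 *: (y - x)).
  apply: cmin; rewrite inE /S/= addrC addKr normrZ normfV normr_id.
  by rewrite mulVf ?gt_eqF.
move/le_trans/(_ (bregman_segment x y _ t01)).
rewrite ler_pdivlMl// => h; rewrite (@le_trans _ _ (r ^+ 2 / bregman phi x c))//.
  by rewrite ler_pdivlMr// (le_trans h)// ltW.
by rewrite lerDr.
Qed.

Lemma msection_open x r : open (msection phi x r).
Proof.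
rewrite (_ : msection phi x r = bregman phi x @^-1` [set t | t < r ^+ 2])//.
apply: open_comp; last exact: open_lt.
by move=> y _; exact: bregman_continuous.
Qed.

End Bregman.

(** * Slopes of the concave envelope *)

Section ContactSlopes.
Context {R : realType}.

(** If the supremum were missed, every point would have a neighbourhood where [g] stays below some
    value less than [s]; compactness makes one such value work on all of [K]. *)
Lemma usc_attains_max {T : topologicalType} (K : set T) (g : T -> R) (B : R) :
  compact K -> K !=set0 -> (forall y, K y -> g y <= B) ->
  (forall x, K x -> forall a, g x < a ->
    \forall y \near within K (nbhs x), g y < a) ->
  exists2 c, K c & forall y, K y -> g y <= g c.
Proof.
move=> cK [x0 Kx0] gB ug; pose s := sup [set g y | y in K].
have ubB : has_ubound [set g y | y in K] by exists B => _ [y Ky <-]; exact: gB.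
have gs y : K y -> g y <= s by move=> Ky; apply: ub_le_sup => //; exists y.
have [[c Kc gc]|nc] := pselect (exists2 c, K c & g c = s).
  by exists c => // y Ky; rewrite gc gs.
have lt_s y : K y -> g y < s.
  move=> Ky; rewrite lt_neqAle gs// andbT; apply/eqP => gy; apply: nc.
  by exists y.
have : \forall i \near s^'-, K `<=` (fun y => K y -> g y < i).
  apply: ((compact_near_coveringP K).1 cK) => x Kx.
  have [xa sa] := (midf_lt (lt_s _ Kx)).
  exists ([set y | K y -> g y < (g x + s) / 2], [set i | (g x + s) / 2 < i]).
    by split; [exact: ug|exact: nbhs_left_gt].
  by case=> y i [/= h1 h2] Ky; apply: lt_trans h2; exact: h1.
move=> H.
have [i [/= Ki i_s]] : exists i, K `<=` (fun y => K y -> g y < i) /\ i < s.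
  near (s^'-) => i; exists i; split; near: i => //.
  exact: nbhs_left_lt.
suff : s <= i by rewrite leNgt i_s.
by apply: ge_sup; [exists (g x0); exists x0|move=> _ [y Ky <-]; rewrite ltW// Ki].
Unshelve. all: by end_near. Qed.

Context {n : nat}.
Local Notation V := 'rV[R]_n.+1.

Lemma usc_sub_dot (K : set V) (u : V -> R) (p : V) : usc_on K u ->
  usc_on K (fun y => u y - dot p y).
Proof.
move=> uu x Kx a xa.
pose e := (a - (u x - dot p x)) / 2.
have e0 : 0 < e by rewrite divr_gt0// subr_gt0.
have h1 : \forall y \near within K (nbhs x), u y < u x + e by apply: uu => //; lra.
have h2 : \forall y \near within K (nbhs x), dot p x - e < dot p y.
  rewrite near_withinE.
  apply: filterS (@cvgr_dist_lt _ _ _ _ _ (dot p) _ (dot_continuous p x) e e0).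
  by move=> y /=; rewrite ltr_distlC => /andP[h _ _]; lra.
near=> y.
have : u y < u x + e by near: y.
have : dot p x - e < dot p y by near: y.
by rewrite /e; lra.
Unshelve. all: by end_near. Qed.

Variables (phi : V -> R) (tau D : R) (u : V -> R).
Local Notation S1 := (msection phi 0 1).
Local Notation St := (msection phi 0 tau).
Hypothesis S1t : S1 `<=` St.
Hypothesis StD : forall y, St y -> `|y| <= D.
Hypothesis uout : forall x, ~ S1 x -> u x <= 0.
Hypothesis uusc : usc_on (closure S1) u.
Hypothesis ubdd : has_ubound (range u).
Local Notation M := (sup (range u)).

Lemma closure_section_bounded : closure S1 `<=` [set y | `|y| <= D].
Proof.
have cD : closed [set y : V | `|y| <= D].
  apply: (@preimage_closed _ _ _ [set t : R | t <= D]); last exact: closed_le.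
  by move=> z _; exact: norm_continuous.
rewrite ((closure_id _).1 cD); apply: closureS => y Sy.
exact: StD (S1t _ Sy).
Qed.

Lemma envelope_le (p : V) (c : R) x : St x -> plane_above phi tau u p c ->
  envelope phi tau u x <= dot p x + c.
Proof.
move=> Sx pc; rewrite /envelope mem_set//; apply: ge_inf; last by exists p, c.
(* Admissible planes dominate the positive part of [u], hence are nonnegative on the section. *)
exists 0 => _ [q [b [qb ->]]]; rewrite (le_trans _ (qb _ Sx))//.
by rewrite le_max lexx orbT.
Qed.

(** The plane given by [p] and [c] guarantees that the infimum is over a nonempty set, so that [inf]
    is not a default value. *)
Lemma le_envelope (p : V) (c : R) x : St x -> plane_above phi tau u p c ->
  u x <= envelope phi tau u x.
Proof.
move=> Sx pc; rewrite /envelope mem_set//; apply: lb_le_inf.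
  by exists (dot p x + c), p, c.
move=> _ [q [b [qb ->]]]; rewrite (le_trans _ (qb _ Sx))//.
by rewrite le_max lexx.
Qed.

(* Among the planes of slope p above u, the lowest one touches the graph of u
   at a maximum point of u - p, where u is at least sup u / 4 > 0. *)
Lemma small_slope_at_contact (p : V) : 0 < M ->
  (forall y : V, `|y| <= D -> `|dot p y| <= M / 4) ->
  superdiff_image phi tau u (contact_set phi tau u) p.
Proof.
move=> M0 pD.
have uM y : u y <= M by apply: ub_le_sup => //; exists y.
have [x0 ux0] : exists x0, 3 / 4 * M < u x0.
  have hs : has_sup (range u) by split => //; exists (u 0); exists 0.
  have e0 : 0 < M / 4 by rewrite divr_gt0.
  by have [_ [x0 _ <-] h] := sup_adherent e0 hs; exists x0; lra.
have pos_in y : 0 < u y -> S1 y.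
  by move=> uy; apply: contrapT => /uout; rewrite leNgt uy.
have Sx0 : S1 x0 by apply: pos_in; rewrite (lt_trans _ ux0)// mulr_gt0.
have cK : compact (closure S1).
  apply: bounded_closed_compact; last exact: closed_closure.
  exists D; split; first exact: num_real.
  by move=> B DB y /closure_section_bounded/le_trans; apply; exact: ltW.
have [x Kx xmax] : exists2 x, closure S1 x &
    forall y, closure S1 y -> u y - dot p y <= u x - dot p x.
  apply: (@usc_attains_max _ _ _ (M + M / 4) cK) => //.
  - by exists x0; exact: subset_closure.
  - move=> y /closure_section_bounded/pD/ler_normlP[h _].
    by have := uM y; lra.
  - exact: usc_sub_dot.
pose c := u x - dot p x.
have /ler_normlP[px1 px2] := pD _ (closure_section_bounded _ Kx).
(* Comparison with [x0] gives [c] above 3M/4 - M/4. Hence [u x] exceeds M/4, which puts [x] in the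
   section itself and not merely in its closure. *)
have c2 : M / 2 < c.
  have := xmax _ (subset_closure Sx0); rewrite -/c.
  have /ler_normlP[_ h] := pD _ (StD _ (S1t _ Sx0)).
  lra.
have Sx : S1 x by apply: pos_in; rewrite /c in c2; lra.
(* Where [u] is nonpositive the plane must still be nonnegative, which [c2] ensures; where [u] is
   positive, maximality at [x] applies. *)
have pc : plane_above phi tau u p c.
  move=> y Sy; have /ler_normlP[h1 h2] := pD _ (StD _ Sy).
  have [uy|uy] := leP (u y) 0; first by rewrite /c in c2 *; lra.
  by have := xmax _ (subset_closure (pos_in _ uy)); rewrite -/c; lra.
have Ex : envelope phi tau u x = u x.
  apply/eqP; rewrite eq_le (le_envelope p c)// ?andbT; last exact: S1t.
  by have := envelope_le p c x (S1t _ Sx) pc; rewrite /c addrC subrK.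
exists x; first by split.
split; first exact: S1t.
move=> y Sy; rewrite Ex (le_trans (envelope_le p c y Sy pc))//.
have -> : dot p y = dot p (y - x) + dot p x by rewrite -dotDr subrK.
by rewrite /c; lra.
Qed.

End ContactSlopes.

(** * Covering by sections *)

Section Covering.
Context {R : realType}.

(* Zorn on the disjoint subfamilies H such that every set meeting H meets a
   member of H of at least half its size. *)
Lemma vitali_selection (T U : Type) (F : set T) (B : T -> set U) (rho : T -> R)
    (r0 : R) :
  (forall x, F x -> B x !=set0) -> (forall x, F x -> 0 < rho x <= r0) ->
  exists H, [/\ H `<=` F, trivIset H B & forall x, F x ->
    exists2 y, H y & B x `&` B y !=set0 /\ rho x <= 2 * rho y].
Proof.
move=> B0 rho0.
pose good (H : set T) x :=
  exists2 y, H y & B x `&` B y !=set0 /\ rho x <= 2 * rho y.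
pose P (H : set T) := [/\ H `<=` F, trivIset H B &
  forall x y, F x -> H y -> B x `&` B y !=set0 -> good H x].
have goodS H H' x : H `<=` H' -> good H x -> good H' x.
  by move=> HH' [y Hy h]; exists y => //; exact: HH'.
have [|A [[AF tA gA] maxA]] := @Zorn_bigcup _ P.
  move=> C CP totC; split.
  - by move=> x [X CX Xx]; have [XF _ _] := CP _ CX; exact: XF.
  - move=> x y [X CX Xx] [Y CY Yy].
    have [_ tX _] := CP _ CX; have [_ tY _] := CP _ CY.
    have [XY|YX] := totC _ _ CX CY.
      by apply: tY => //; exact: XY.
    by apply: tX => //; exact: YX.
  - move=> x y Fx [X CX Xy] xy; have [_ _ gX] := CP _ CX.
    by apply: goodS (gX _ _ Fx Xy xy) => z Xz; exists X.
exists A; split => // x Fx.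
have [[y Ay xy]|nx] := pselect (exists2 y, A y & B x `&` B y !=set0).
  exact: gA xy.
(* If [B x] misses the whole family, then among all sets that miss it some [B b] has size above half
   the supremum [s]; adding [b] to [A] preserves [P], against maximality. *)
pose N := [set z | F z /\ forall y, A y -> ~ (B z `&` B y !=set0)].
have Nx : N x by split => // y Ay xy; apply: nx; exists y.
pose s := sup [set rho z | z in N].
have hs : has_sup [set rho z | z in N].
  split; first by exists (rho x), x.
  by exists r0 => _ [z [/rho0/andP[_ h] _] <-].
have rs z : N z -> rho z <= s by move=> Nz; apply: (ub_le_sup hs.2); exists z.
have s0 : 0 < s by rewrite (lt_le_trans _ (rs _ Nx))//; case/andP: (rho0 _ Fx).
have [_ [b Nb <-] sb] := sup_adherent (divr_gt0 s0 (ltr0n _ 2)) hs.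
have [Fb nb] := Nb.
exfalso; apply: (maxA (A `|` [set b])).
  split; first exact: subsetUl.
  move=> /(_ b (or_intror erefl)) Ab; apply: (nb b Ab); rewrite setIid; exact: B0.
split.
- by move=> z [/AF//|->].
- move=> y z [Ay|->] [Az|->] // yz; first exact: tA.
  + by exfalso; apply: (nb y Ay); rewrite setIC.
  + by exfalso; exact: (nb z Az).
- move=> z y Fz Ay' zy.
  have [[w Aw zw]|nz] := pselect (exists2 w, A w & B z `&` B w !=set0).
    by apply: goodS (gA _ _ Fz Aw zw); exact: subsetUl.
  have Nz : N z by split => // w Aw zw; apply: nz; exists w.
  exists b; first by right.
  split; last by have := rs _ Nz; rewrite -/s in sb; lra.
  by case: Ay' zy => [Ay|->//] zy; exfalso; apply: nz; exists y.
Qed.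

Context {n : nat}.
Local Notation V := 'rV[R]_n.+1.

(** Each [B x] contains a nonempty rational box, and disjointness makes this choice injective. *)
Lemma disjoint_open_countable (H : set V) (B : V -> set V) :
  (forall x, H x -> open (B x)) -> (forall x, H x -> B x !=set0) ->
  trivIset H B -> countable H.
Proof.
move=> oB B0 tB; apply/countable_injP.
have [g gP] : {g : V -> 'rV[rat]_n.+1 * 'rV[rat]_n.+1 & forall x, H x ->
    let b : set V := box (map_mx ratr (g x).1, map_mx ratr (g x).2) in
    b !=set0 /\ b `<=` B x}.
  apply: (@choice _ _ (fun x pq => H x ->
    let b : set V := box (map_mx ratr pq.1, map_mx ratr pq.2) in
    b !=set0 /\ b `<=` B x)) => x.
  have [Hx|nHx] := pselect (H x); last by exists (0, 0).
  have [z Bz] := B0 _ Hx.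
  have [e e0 eB] := open_nbhs_coord _ _ (oB _ Hx) Bz.
  have [pq [zb be]] := rat_box z e e0.
  by exists pq => _; split; [exists z|move=> y yb; apply: eB; exact: be].
exists (fun x => pickle (g x)) => x y; rewrite !inE => Hx Hy.
move=> /(pcan_inj (@pickleK _)) gxy.
have [[z zb] bx] := gP _ Hx; have [_ by_] := gP _ Hy.
by apply: tB => //; exists z; split; [exact: bx|apply: by_; rewrite -gxy].
Qed.

(** Subadditivity bounds the union of the [A x], while countable additivity is exact on the disjoint
    open [B x]. *)
Lemma leb_bigcup_le (H : set V) (A B : V -> set V) (c : R) :
  countable H -> 0 <= c ->
  (forall x, H x -> open (B x)) -> trivIset H B ->
  (forall x, H x -> (leb (A x) <= c%:E * leb (B x))%E) ->
  (leb (\bigcup_(x in H) A x) <= c%:E * leb (\bigcup_(x in H) B x))%E.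
Proof.
move=> /countable_injP[g ginj] c0 oB tB AB.
have [e eK] : {e : nat -> V & forall k x, H x -> g x = k -> e k = x}.
  apply: (@choice _ _ (fun k y => forall x, H x -> g x = k -> y = x)) => k.
  have [[y Hy gy]|nk] := pselect (exists2 y, H y & g y = k).
    by exists y => x Hx gx; apply: ginj; rewrite ?inE// gy gx.
  by exists 0 => x Hx gx; exfalso; apply: nk; exists x.
have {}eK x : H x -> e (g x) = x by move=> Hx; exact: eK.
pose D := g @` H.
have De k : D k -> H (e k) by move=> [x Hx <-]; rewrite eK.
have bigE (Z : V -> set V) : \bigcup_(x in H) Z x = \bigcup_(k in D) Z (e k).
  apply/seteqP; split=> z [x Hx xz]; last by exists (e x) => //; exact: De.
  by exists (g x); [exists x|rewrite eK].
rewrite !bigE.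
have -> : leb (\bigcup_(k in D) B (e k)) =
    (\sum_(k <oo | k \in D) leb (B (e k)))%E.
  apply: (@measure_bigcup _ _ _ (@lebesgue_rV R n) D (fun k => B (e k))).
    by move=> k /De Hk; apply: open_caratheodory; exact: oB.
  move=> j k Dj Dk /tB => /(_ (De _ Dj) (De _ Dk)) ejk.
  by case: Dj Dk ejk => x Hx <- [y Hy <-]; rewrite !eK// => ->.
rewrite -nneseriesZl; last first.
  by move=> k _; exact: (@outer_measure_ge0 _ _ leb_outer).
rewrite bigcup_mkcond.
apply: (le_trans (@outer_measure_sigma_subadditive _ _ leb_outer _)).
rewrite [leRHS]eseries_mkcond; apply: lee_nneseries => [k _ _|k _].
  exact: outer_measure_ge0.
by case: ifPn => [/set_mem/De/AB//|_]; rewrite outer_measure0.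
Qed.

Variable phi : V -> R.

Lemma msection_le x (r s : R) : 0 <= r -> r <= s ->
  msection phi x r `<=` msection phi x s.
Proof.
move=> r0 rs y /lt_le_trans; apply.
by rewrite ler_pXn2r// nnegrE (le_trans r0).
Qed.

(** Engulfing at a common point [z] puts both [x] and [y] in the section of size [2 * gamma * s] at
    [z]; engulfing once more, from [z] to [y], costs the second factor [gamma]. *)
Lemma engulfing_meet gamma x y (r s : R) :
  engulfing phi gamma -> 0 < r -> 0 < s ->
  msection phi x r x -> msection phi y s y ->
  msection phi x r `&` msection phi y s !=set0 -> r <= 2 * s ->
  msection phi y (2 * gamma ^+ 2 * s) x.
Proof.
move=> [g1 eng] r0 s0 xx yy [z [zx zy]] rs.
have g0 : 0 < gamma by rewrite (lt_trans ltr01).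
have xz : msection phi z (2 * gamma * s) x.
  apply: (@msection_le z (gamma * r)); first by rewrite mulr_ge0 ?ltW.
    by rewrite mulrAC mulrC ler_pM2r.
  exact: eng zx _ xx.
have yz : msection phi z (2 * gamma * s) y.
  apply: (@msection_le z (gamma * s)); first by rewrite mulr_ge0 ?ltW.
    by rewrite -mulrA ler_peMl ?ler1n// mulr_ge0 ?ltW.
  exact: eng zy _ yy.
have := eng _ _ _ _ yz _ xz; rewrite [gamma * _]mulrC.
rewrite (_ : 2 * gamma * s * gamma = 2 * gamma ^+ 2 * s); last by ring.
by apply; rewrite !mulr_gt0.
Qed.

(* Doubling: v_x(x + (y - x) / k^2) <= v_x(y) / k^2 by convexity, so dilating
   S_r(x) by k^2 around x covers S_(kr)(x). *)
Lemma leb_msection_scale x (k r : R) :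
  @convex_function R V setT phi -> 1 <= k ->
  (leb (msection phi x (k * r))
   <= ((k ^+ 2) ^+ n.+1)%:E * leb (msection phi x r))%E.
Proof.
move=> hconv k1; have k0 : 0 < k by rewrite (lt_le_trans ltr01).
have k20 : 0 < k ^+ 2 by rewrite exprn_gt0.
have t0 : 0 < (k ^+ 2)^-1 by rewrite invr_gt0.
have := leb_preimage_affine (msection phi x r) _ (x - (k ^+ 2)^-1 *: x) t0.
rewrite invrK; apply: le_trans; apply: (@le_outer_measure _ _ leb_outer) => y /=.
rewrite /msection/= => yk.
have -> : (k ^+ 2)^-1 *: y + (x - (k ^+ 2)^-1 *: x) = x + (k ^+ 2)^-1 *: (y - x).
  by rewrite scalerBr addrCA.
have t01 : 0 <= (k ^+ 2)^-1 <= 1.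
  by rewrite ltW//= invf_le1// exprn_ege1.
apply: (le_lt_trans (bregman_segment phi hconv x y _ t01)).
by rewrite ltr_pdivrMl// -exprMn.
Qed.

End Covering.

(* R^d with d = n.+1 >= 1.  C is independent of u and of the family r, and
   depends on f only through a bound K of |f|.  The left-hand side is
   sup u when sup u >= 0 and 0 otherwise: for sup u < 0 the contact set is
   empty, while (sup u)^d is positive for even d. *)
Theorem corollary3p2 (R : realType) (n : nat)
    (gm gp : R) (hgm : 0 < gm) (hgmp : gm <= gp)
    (phi : 'rV[R]_n.+1 -> R)
    (hconv : @convex_function R 'rV[R]_n.+1 setT phi)
    (hC2 : C2_on setT phi)
    (hdet : forall x, gm <= \det (hessian phi x) <= gp)
    (gamma tau : R) (hgamma : engulfing phi gamma)
    (hgt : gamma < tau) (htau : separating phi tau)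
    (lambda Lambda sigma : R) (hlambda : 0 < lambda) (hLambda : lambda <= Lambda)
    (hsigma : 0 < sigma < 2)
    (eps C1 : R) (heps : 0 < eps < 1) (hC1 : 0 < C1)
    (K : R) :
  exists C : R, 0 < C /\
    forall f : 'rV[R]_n.+1 -> R, continuous f -> (forall x, `|f x| <= K) ->
    forall u : 'rV[R]_n.+1 -> R,
    (forall x, ~ msection phi 0 1 x -> u x <= 0) ->
    Mplus_visc_ge phi lambda Lambda sigma (msection phi 0 1) u f ->
    forall r : 'rV[R]_n.+1 -> R,
    detachment_family phi tau u sigma eps C1 f r ->
    ((C * Num.max (sup (range u)) 0 ^+ n.+1)%:E
     <= leb (\bigcup_(x in contact_set phi tau u) msection phi x (r x)))%E.
Proof.
have hdet0 x : \det (hessian phi x) != 0.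
  by have /andP[h _] := hdet x; rewrite gt_eqF// (lt_le_trans hgm).
have [D D0 StD] := msection_bounded phi hconv hC2 hdet0 0 tau.
have {}StD y : msection phi 0 tau y -> `|y| <= D by move/StD; rewrite subr0.
have [g1 _] := hgamma; have g0 : 0 < gamma by rewrite (lt_trans ltr01).
have S1t : msection phi 0 1 `<=` msection phi 0 tau.
  by apply: msection_le => //; rewrite ltW// (lt_trans g1).
pose k : R := 2 * gamma ^+ 2.
have k1 : 1 <= k.
  have : 1 <= gamma ^+ 2 by rewrite exprn_ege1// ltW.
  by rewrite /k; lra.
have k0 : 0 < k by rewrite (lt_le_trans ltr01).
have K0 : 0 < `|K| + 1 by rewrite ltr_wpDl.
(* The factors before the last bound the slopes over one section, with [K0] valid whatever the sign
   of [K]; the last is the doubling constant for dilation by [k]. *)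
pose c := C1 * (`|K| + 1) ^+ n.+1 * (k ^+ 2) ^+ n.+1.
have c0 : 0 < c by rewrite !mulr_gt0// !exprn_gt0.
(* Slopes with coordinates at most [b * M] then satisfy |p.y| <= M/4 for |y| <= D, as
   [small_slope_at_contact] requires. *)
pose b : R := (4 * (n.+1%:R * D))^-1.
have b0 : 0 < b by rewrite invr_gt0 !mulr_gt0.
exists (c^-1 * b ^+ n.+1); split; first by rewrite mulr_gt0 ?invr_gt0 ?exprn_gt0.
move=> f _ fK u uout [uusc _] r rP.
set M := sup (range u).
have [M0|M0] := leP M 0.
  by rewrite expr0n mulr0; exact: (@outer_measure_ge0 _ _ leb_outer).
(* The [sup] of an unbounded set is 0 by default, so [0 < M] forces an upper bound. *)
have ubdd : has_ubound (range u).
  apply: contrapT => nub; move: M0; rewrite /M sup_out ?ltxx// => -[_]; exact: nub.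
set Sigma := contact_set phi tau u in rP *.
have r0 x : Sigma x -> 0 < r x < 2 `^ (- (2 - sigma)^-1) by case/rP.
(* Enlarging the section of size [rho x] by the engulfing factor [k] gives exactly the quarter
   section of the detachment family. *)
pose rho x := r x / 4 / k.
have krho x : k * rho x = r x / 4 by rewrite /rho mulrC divfK// gt_eqF.
pose B x := msection phi x (rho x).
have rho0 x : Sigma x -> 0 < rho x.
  by case/r0/andP => rx _; rewrite /rho !divr_gt0.
have xB x s : 0 < s -> msection phi x s x.
  by move=> s0; rewrite /msection/= bregman_xx exprn_gt0.
have [H [HS tH covH]] : exists H, [/\ H `<=` Sigma, trivIset H B &
    forall x, Sigma x -> exists2 y, H y &
      B x `&` B y !=set0 /\ rho x <= 2 * rho y].
  apply: (@vitali_selection _ _ _ _ _ _ (2 `^ (- (2 - sigma)^-1) / 4 / k)).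
    by move=> x Sx; exists x; apply: xB; exact: rho0.
  move=> x Sx; rewrite rho0//= /rho !ler_pM2r ?invr_gt0//.
  by have /andP[_ /ltW] := r0 _ Sx.
have oB x : open (B x) by exact: msection_open.
have cH : countable H.
  apply: disjoint_open_countable tH => // x /HS Sx.
  by exists x; apply: xB; exact: rho0.
pose A x := superdiff_image phi tau u (msection phi x (r x / 4)).
have AB x : H x -> (leb (A x) <= c%:E * leb (B x))%E.
  move=> /HS Sx; have [_ _ h] := rP _ Sx.
  apply: (le_trans h).
  apply: (@le_trans _ _ ((C1 * (`|K| + 1) ^+ n.+1)%:E *
      leb (msection phi x (k * rho x)))%E).
    rewrite krho lee_wpmul2r ?(@outer_measure_ge0 _ _ leb_outer)// lee_fin.
    rewrite ler_pM2l// (le_trans (ler_norm _))// normrX.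
    apply: lerXn2r; rewrite ?nnegrE ?(ltW K0)//.
    by rewrite (le_trans (fK x))// (le_trans (ler_norm K))// lerDl.
  rewrite /c [X in (_ <= X * _)%E]EFinM -muleA; apply: lee_wpmul2l.
    by rewrite lee_fin mulr_ge0 ?exprn_ge0// ltW.
  exact: leb_msection_scale.
(* A slope at [x] in [Sigma] is charged to the selected [y] whose section meets that of [x] and has
   at least half its size: [x] lies in the quarter section at [y]. *)
have sub : superdiff_image phi tau u Sigma `<=` \bigcup_(x in H) A x.
  move=> p [x Sx xp]; have [y Hy [xy rxy]] := covH _ Sx.
  exists y => //; exists x => //.
  rewrite -krho.
  have Sy := HS _ Hy.
  by apply: engulfing_meet xy rxy;
    do ?[exact: hgamma|exact: rho0|exact: xB (rho0 _ _)].
have cube : (((b * M) ^+ n.+1)%:E <= leb (superdiff_image phi tau u Sigma))%E.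
  have bM : 0 < b * M by rewrite mulr_gt0.
  apply: (le_trans (leb_cube_ge _ bM)); apply: (@le_outer_measure _ _ leb_outer).
  move=> p pb; apply: (small_slope_at_contact phi tau D) => // y yD.
  apply: (le_trans (dot_bound _ _ _ _ pb yD)).
  rewrite -/M le_eqVlt; apply/orP; left; apply/eqP; rewrite /b; field.
  by rewrite (gt_eqF D0) nat1r pnatr_eq0.
rewrite -mulrA -exprMn EFinM lee_pdivrMl//.
apply: (le_trans cube); apply: (le_trans (@le_outer_measure _ _ leb_outer _ _ sub)).
apply: (le_trans (leb_bigcup_le _ _ _ _ cH (ltW c0) (fun x _ => oB x) tH AB)).
rewrite lee_wpmul2l ?lee_fin ?(ltW c0)//; apply: (@le_outer_measure _ _ leb_outer).
(* Since [4 * k >= 1], the selected sections lie in the full sections of the family. *)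
move=> y [x /HS Sx xy]; exists x => //; apply: msection_le xy.
  exact: ltW (rho0 _ Sx).
have /andP[rx _] := r0 _ Sx.
rewrite /rho -mulrA ler_piMr ?(ltW rx)// -invfM invf_le1 ?mulr_gt0//.
by rewrite (le_trans k1)// ler_peMl ?(ltW k0)// ler1n.
Qed.
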